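(* Let $M$ be a persistence module indexed by $[m]$, with rank function $\operatorname{Rank}=\operatorname{Rank}(M):[m+1]^2_<\to\mathbb{Z}_{\ge 0}$, $k$-th graded rank functions $\operatorname{Rank}_k=u_k\circ\operatorname{Rank}$ ($k\ge 1$), persistence diagram $\operatorname{PD}=\mu*\operatorname{Rank}$ and $k$-th graded persistence diagrams $\operatorname{PD}_k=\mu*\operatorname{Rank}_k$ ($k\geq 1$). Then: (a) the operations $\mu * -$ and $\zeta * -$ are inverse to each other, so that $\operatorname{PD}=\mu*\operatorname{Rank}$ and $\operatorname{Rank}=\zeta*\operatorname{PD}$, and for every $k\ge 1$, $\operatorname{PD}_k=\mu*\operatorname{Rank}_k$ and $\operatorname{Rank}_k=\zeta*\operatorname{PD}_k$; (b) $\sum_{k\ge 1}\operatorname{Rank}_k=\operatorname{Rank}$ (pointwise sum, with finitely many nonzero terms at each point); (c) $\sum_{k\ge 1}\operatorname{PD}_k=\operatorname{PD}$ (pointwise sum, with finitely many nonzero terms at each point).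
   Context: Let $[m]=\{0<1<\dots<m\}$ and let $F$ be a field. A persistence module $M$ indexed by $[m]$ is a functor from the poset $[m]$ to finite-dimensional $F$-vector spaces. Let $[m+1]^2_<$ be the finite poset of half-open intervals $[a,b)$ with $a<b$ in $[m+1]=\{0,\dots,m+1\}$, ordered by inclusion: $[a,b)\le[a',b')$ iff $a'\le a$ and $b\le b'$. Define $\operatorname{Rank}(M)[a,b)=\operatorname{rank}\big(M(a\le b-1)\big)$ for $[a,b)\in[m+1]^2_<$. For $k\ge1$, $u_k:\mathbb{Z}_{\ge0}\to\mathbb{Z}$ is given by $u_k(n)=1$ if $n\ge k$ and $u_k(n)=0$ otherwise. For a locally finite poset $P$, the zeta function $\zeta$ has $\zeta[x,y]=1$ for all $x\le y$; the Möbius function $\mu$ is defined recursively by $\mu[x,x]=1$ and $\mu[x,y]=-\sum_{x\le y'<y}\mu[x,y']$ for $x<y$. Here $\mu,\zeta$ are those of $P=[m+1]^2_<$, with integer values. For a function $f$ on pairs $x\le y$ in $P$ and $h:P\to\mathbb{Z}$ ($P$ finite with largest element), $(f*h)(x)=\sum_{x\le x'}f[x,x']\,h(x')$. *)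

(* Defs.v *)
From HB Require Import structures.
From mathcomp Require Import all_boot all_order all_algebra.
From mathcomp Require Import zify.

Set Implicit Arguments.
Unset Strict Implicit.
Unset Printing Implicit Defensive.

Import Order.TTheory GRing.Theory Num.Theory.

Local Open Scope ring_scope.

(* A functor from the poset P to finite-dimensional F-vector spaces. *)
Record persmod (F : fieldType) (d : Order.disp_t) (P : porderType d) :=
  PersMod {
    pm_obj : P -> vectType F;
    pm_map : forall i j : P, (i <= j)%O -> 'Hom(pm_obj i, pm_obj j);
    pm_map_id : forall (i : P) (le_ii : (i <= i)%O), pm_map le_ii = \1%VF;
    pm_map_comp : forall (i j k : P)
      (le_ij : (i <= j)%O) (le_jk : (j <= k)%O) (le_ik : (i <= k)%O),
      pm_map le_ik = (pm_map le_jk \o pm_map le_ij)%VF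
  }.

Section Incidence.
Variables (d : Order.disp_t) (P : finPOrderType d).
Implicit Types (f : P -> P -> int) (h : P -> int) (x y z : P).

(* Functions on pairs x <= y are represented by total functions of x and y;
   [zeta] and [mobius] vanish off the order relation. *)
Definition zeta x y : int := if (x <= y)%O then 1 else 0.

(* [n] bounds the depth of the recursion; see [mobius_xx] and [mobius_lt]. *)
Fixpoint mobius_rec (n : nat) x y : int :=
  if x == y then 1
  else if n is n'.+1 then - \sum_(z : P | (x <= z < y)%O) mobius_rec n' x z
  else 0.

Definition mobius x y : int := mobius_rec #|P| x y.

Definition conv f h : P -> int :=
  fun x => \sum_(x' : P | (x <= x')%O) f x x' * h x'.

Lemma mobius_rec_stable n1 n2 x y :
  (#|[pred z : P | (x <= z < y)%O]| <= n1)%N ->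
  (#|[pred z : P | (x <= z < y)%O]| <= n2)%N ->
  mobius_rec n1 x y = mobius_rec n2 x y.
Proof.
elim: n1 n2 y => [|n1 IH] [|n2] y //=.
- rewrite leqn0 => /eqP/card0_eq E _; case: eqP => // _.
  by rewrite big_pred0 ?oppr0 // => z; apply: (E z).
- move=> _; rewrite leqn0 => /eqP/card0_eq E; case: eqP => // _.
  by rewrite big_pred0 ?oppr0 // => z; apply: (E z).
move=> H1 H2; case: eqP => // _; congr (- _).
apply: eq_bigr => z xzy; case/andP: (xzy) => xz zy.
have lt : (#|[pred w : P | (x <= w < z)%O]|
            < #|[pred w : P | (x <= w < y)%O]|)%N.
  apply: proper_card; apply/properP; split.
    apply/subsetP => w; rewrite !inE => /andP[-> wz] /=.
    exact: lt_trans wz zy.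
  by exists z; rewrite !inE ?xzy // ltxx andbF.
by apply: IH; rewrite -ltnS; apply: leq_trans lt _.
Qed.

Lemma mobius_xx x : mobius x x = 1.
Proof. by rewrite /mobius; case: #|P| => [|n] /=; rewrite eqxx. Qed.

Lemma mobius_lt x y : (x < y)%O ->
  mobius x y = - \sum_(y' : P | (x <= y' < y)%O) mobius x y'.
Proof.
move=> xy; transitivity (mobius_rec #|P|.+1 x y).
  by apply: mobius_rec_stable; rewrite ?leqW // max_card.
by rewrite /= lt_eqF.
Qed.

End Incidence.

(* [intv m] is the poset of the half-open intervals [a, b), a < b in
   {0, ..., m + 1}, ordered by inclusion. *)
Record intv (m : nat) := Intv {
  intv_ends : 'I_m.+2 * 'I_m.+2;
  _ : (intv_ends.1 < intv_ends.2)%N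
}.

HB.instance Definition _ (m : nat) := [isSub for @intv_ends m].
HB.instance Definition _ (m : nat) := [Finite of intv m by <:].

Section IntvOrder.
Variable m : nat.
Implicit Types I J K : intv m.

Definition lo I : 'I_m.+2 := (intv_ends I).1.
Definition hi I : 'I_m.+2 := (intv_ends I).2.

Lemma lo_lt_hi I : (lo I < hi I)%N.
Proof. by case: I. Qed.

Definition intv_le I J : bool := (lo J <= lo I)%N && (hi I <= hi J)%N.

Lemma intv_le_refl : reflexive intv_le.
Proof. by move=> I; rewrite /intv_le !leqnn. Qed.

Lemma intv_le_anti : antisymmetric intv_le.
Proof.
move=> I J /andP[/andP[lJI hIJ] /andP[lIJ hJI]]; apply: val_inj => /=.
rewrite [LHS]surjective_pairing [RHS]surjective_pairing.
by congr (_, _); apply/val_inj/anti_leq/andP; split.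
Qed.

Lemma intv_le_trans : transitive intv_le.
Proof.
move=> J I K /andP[lJI hIJ] /andP[lKJ hJK].
by rewrite /intv_le (leq_trans lKJ lJI) (leq_trans hIJ hJK).
Qed.

End IntvOrder.

Fact intv_display : Order.disp_t. Proof. exact: Order.Disp tt tt. Qed.

HB.instance Definition _ (m : nat) :=
  Order.Le_isPOrder.Build intv_display (intv m)
    (@intv_le_refl m) (@intv_le_anti m) (@intv_le_trans m).

Lemma intv_leE (m : nat) (I J : intv m) :
  (I <= J)%O = (lo J <= lo I)%N && (hi I <= hi J)%N.
Proof. by []. Qed.

Section Rank.
Variables (F : fieldType) (m : nat) (M : persmod F 'I_m.+1).
Implicit Types (I : intv m) (k : nat).

Fact lo_bound I : (lo I < m.+1)%N.
Proof. by have := lo_lt_hi I; have := ltn_ord (hi I); lia. Qed.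

Fact hi_pred_bound I : ((hi I).-1 < m.+1)%N.
Proof. by have := lo_lt_hi I; have := ltn_ord (hi I); lia. Qed.

Definition first_idx I : 'I_m.+1 := Ordinal (lo_bound I).
Definition last_idx I : 'I_m.+1 := Ordinal (hi_pred_bound I).

Fact first_le_last I : (first_idx I <= last_idx I)%O.
Proof. by have := lo_lt_hi I; rewrite leEord /=; lia. Qed.

Definition Rank I : nat := \dim (limg (pm_map M (first_le_last I))).

Definition u k (n : nat) : int := if (k <= n)%N then 1 else 0.

Definition Rank_int I : int := (Rank I)%:Z.

Definition graded_Rank k I : int := u k (Rank I).

Definition PD : intv m -> int := conv (@mobius _ (intv m)) Rank_int.

Definition graded_PD k : intv m -> int :=
  conv (@mobius _ (intv m)) (graded_Rank k).

End Rank.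

(* Main.v *)
Require Import Defs.
From mathcomp Require Import all_boot all_order all_algebra.
From mathcomp Require Import classical_sets cardinality fsbigop.
Set Implicit Arguments.
Unset Strict Implicit.
Unset Printing Implicit Defensive.
Import Order.TTheory GRing.Theory Num.Theory.
Local Open Scope ring_scope.

(** Part (a) is Moebius inversion on a finite poset. The recursion that defines
    [mobius] says that its sum over a nontrivial closed interval vanishes, so
    [mobius] is a left inverse of [zeta] ([mobius_zetaK]). Being triangular
    with 1 on the diagonal, [mobius] acts injectively on functions
    ([conv_inj]), and a left inverse that is injective is also a right inverse:
    the two sides of [zeta_mobiusK] have the same image under [mobius].

    For (b), the functions [u k] slice a natural number into units: [n] is the
    number of [k >= 1] with [k <= n]. As the poset is finite, the rank function
    is bounded by some [N], hence the sum over [k >= 1] can be cut off at [N]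
    simultaneously at all points. With this uniform cut-off, (c) follows from
    (b) because convolution with [mobius] commutes with finite sums
    ([conv_sum]). *)

Section MobiusInversion.
Variables (d : Order.disp_t) (P : finPOrderType d).
Implicit Types (f : P -> P -> int) (h g : P -> int) (x y z : P).

Lemma eq_conv f h g : h =1 g -> conv f h =1 conv f g.
Proof. by move=> hg x; apply: eq_bigr => y _; rewrite hg. Qed.

(** For [x < z], isolating the term [y = z] leaves exactly the sum that the
    recursion negates to define [mobius x z]. *)
Lemma sum_mobius x z : (x <= z)%O ->
  \sum_(y : P | (x <= y <= z)%O) mobius x y = (x == z)%:R.
Proof.
move=> xz; rewrite (bigD1 z) /=; last by rewrite xz lexx.
have -> : \sum_(y : P | (x <= y <= z)%O && (y != z)) mobius x y
          = \sum_(y : P | (x <= y < z)%O) mobius x y.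
  by apply: eq_bigl => y; rewrite lt_def eq_sym -andbA [_ && (_ != _)]andbC.
have [<-|neq] := eqVneq x z.
  rewrite mobius_xx big_pred0 ?addr0 // => y.
  by apply/negP => /andP[/le_lt_trans H /H]; rewrite ltxx.
by rewrite mobius_lt ?addNr // lt_neqAle neq.
Qed.

(** After exchanging the two sums, [h z] has coefficient the sum of
    [mobius x y] over [x <= y <= z], which [sum_mobius] evaluates. *)
Lemma mobius_zetaK h : conv (@mobius d P) (conv (@zeta d P) h) =1 h.
Proof.
move=> x; rewrite /conv.
under eq_bigr do rewrite big_distrr /=.
rewrite (exchange_big_dep (fun z => (x <= z)%O)) /=; last first.
  by move=> y z; apply: le_trans.
rewrite (eq_bigr (fun z => (x == z)%:R * h z)).
  rewrite (bigD1 x) //= eqxx mul1r big1 ?addr0 // => z /andP[_].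
  by rewrite eq_sym => /negPf->; rewrite mul0r.
move=> z xz; rewrite -sum_mobius // big_distrl /=.
by apply: eq_bigr => y /andP[_ yz]; rewrite /zeta yz mul1r.
Qed.

(** Back substitution in a unitriangular system: going down from the maximal
    elements, [conv f h x] is [h x] plus a combination of values of [h] strictly
    above [x], which are already known. *)
Lemma conv_inj f h g : (forall x, f x x = 1) ->
  conv f h =1 conv f g -> h =1 g.
Proof.
move=> f1 E x; have [n] := ubnP #|[pred y : P | (x < y)%O]|.
elim: n x => // n IH x xn; have := E x.
rewrite /conv (bigD1 x) //= [in RHS](bigD1 x) //= f1 !mul1r.
rewrite (eq_bigr (fun y => f x y * g y)); first exact: addIr.
move=> y /andP[xy yx]; rewrite IH //.
have {yx}xy : (x < y)%O by rewrite lt_def yx.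
rewrite -ltnS; apply: leq_trans xn; rewrite ltnS; apply: proper_card.
apply/properP; split; last by exists y; rewrite !inE ?xy ?ltxx.
by apply/fintype.subsetP => z; rewrite !inE; apply: lt_trans.
Qed.

(** Injectivity of [mobius] upgrades the left inverse to a two-sided one,
    avoiding a second recursion for [mobius] in its first argument. *)
Lemma zeta_mobiusK h : conv (@zeta d P) (conv (@mobius d P) h) =1 h.
Proof.
apply: (@conv_inj (@mobius d P)) => [x|]; first exact: mobius_xx.
exact: mobius_zetaK.
Qed.

Lemma conv_sum (J : Type) (r : seq J) f (h : J -> P -> int) x :
  conv f (fun y => \sum_(k <- r) h k y) x = \sum_(k <- r) conv f (h k) x.
Proof.
by rewrite /conv exchange_big /=; apply: eq_bigr => y _; rewrite big_distrr.
Qed.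

End MobiusInversion.

(** Turns a sum over an infinite index set, which is 0 by convention when the
    support is infinite, into a plain finite sum. *)
Lemma fsum_bounded_support (V : nmodType) (N : nat) (f : nat -> V) :
  (forall k, (N < k)%N -> f k = 0) ->
  finite_set [set k : nat | (1 <= k)%N /\ f k != 0] /\
  \sum_(k \in [set k : nat | (1 <= k)%N]) f k = \sum_(1 <= k < N.+1) f k.
Proof.
move=> f0.
have le_N k : f k != 0 -> (k <= N)%N.
  by apply: contra_neqT; rewrite -ltnNge => /f0.
have sub : ([set k : nat | (1 <= k)%N /\ f k != 0] `<=`
            [set` index_iota 1 N.+1])%classic.
  by move=> k [k1 /le_N kN] /=; rewrite mem_index_iota k1.
split; first exact: sub_finite_set sub (finite_seq _).
rewrite [RHS]fsbig_seq ?iota_uniq //; apply/esym/fsbig_widen.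
  by move=> k /=; rewrite mem_index_iota => /andP[].
move=> k /= [k1]; rewrite mem_index_iota k1 /= => /negP.
by rewrite ltnS -ltnNge => /f0.
Qed.

Lemma sum_u (N n : nat) : (n <= N)%N -> \sum_(1 <= k < N.+1) u k n = n%:Z.
Proof.
move=> nN; rewrite (big_cat_nat (n := n.+1)) //= [X in _ + X]big_nat_cond.
rewrite [X in _ + X]big1 ?addr0 => [|k /andP[/andP[nk _] _]]; last first.
  by rewrite /u leqNgt nk.
rewrite (eq_big_nat _ _ (F2 := fun=> 1)) => [|k /andP[_ kn]].
  by rewrite sumr_const_nat subn1 /= natz.
by rewrite /u -ltnS kn.
Qed.

Section Graded.
Variables (F : fieldType) (m : nat) (M : persmod F 'I_m.+1).

Definition max_Rank : nat := \max_I Rank M I.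

(** [max_Rank] is one cut-off for all intervals at once; a cut-off depending on
    the interval would not pass through the convolution. *)
Lemma graded_Rank_gt_max k : (max_Rank < k)%N -> graded_Rank M k =1 fun=> 0.
Proof.
move=> lt_k I; rewrite /graded_Rank /u leqNgt (leq_ltn_trans _ lt_k) //.
exact: leq_bigmax.
Qed.

Lemma graded_PD_gt_max k : (max_Rank < k)%N -> graded_PD M k =1 fun=> 0.
Proof.
move=> lt_k I; rewrite /graded_PD (eq_conv _ (graded_Rank_gt_max lt_k)).
by rewrite /conv big1 // => J _; rewrite mulr0.
Qed.

Lemma sum_graded_Rank I :
  \sum_(1 <= k < max_Rank.+1) graded_Rank M k I = Rank_int M I.
Proof. by apply: sum_u; apply: leq_bigmax. Qed.

Lemma sum_graded_PD I :
  \sum_(1 <= k < max_Rank.+1) graded_PD M k I = PD M I.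
Proof. by rewrite -conv_sum; apply/eq_conv/sum_graded_Rank. Qed.

End Graded.

Theorem theorem4p5 (F : fieldType) (m : nat) (M : persmod F 'I_m.+1) :
  let mu := @mobius _ (intv m) in
  let ze := @zeta _ (intv m) in
  [/\ [/\ (forall h : intv m -> int,
             conv ze (conv mu h) =1 h /\ conv mu (conv ze h) =1 h),
          PD M =1 conv mu (Rank_int M) /\ Rank_int M =1 conv ze (PD M)
        & forall k : nat, (1 <= k)%N ->
            graded_PD M k =1 conv mu (graded_Rank M k) /\
            graded_Rank M k =1 conv ze (graded_PD M k)],
      (forall I : intv m,
         finite_set [set k : nat | (1 <= k)%N /\ graded_Rank M k I != 0] /\
         \sum_(k \in [set k : nat | (1 <= k)%N]) graded_Rank M k I
           = Rank_int M I)
    & (forall I : intv m,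
         finite_set [set k : nat | (1 <= k)%N /\ graded_PD M k I != 0] /\
         \sum_(k \in [set k : nat | (1 <= k)%N]) graded_PD M k I = PD M I)].
Proof.
move=> mu ze; split.
- split=> [h||k _]; first by split; [exact: zeta_mobiusK|exact: mobius_zetaK].
    by split=> // I; rewrite zeta_mobiusK.
  by split=> // I; rewrite zeta_mobiusK.
- move=> I; rewrite -sum_graded_Rank; apply: fsum_bounded_support => k lt_k.
  exact: graded_Rank_gt_max.
- move=> I; rewrite -sum_graded_PD; apply: fsum_bounded_support => k lt_k.
  exact: graded_PD_gt_max.
Qed.
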